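(* Let $n\ge 2$ and $k\ge 1$ be integers and let $a\in\mathbb{Z}$ with $\gcd(a,n)=1$. Let $a^{-1}$ denote an integer that is a multiplicative inverse of $a$ modulo $n$. Then $$\left(\frac{a^{-1}}{n}\right)_k=\left(\frac{a}{n}\right)_k.$$
   Context: For integers $n\ge 2$, $k\ge 1$ and $a\in\mathbb{Z}$, the exponential congruence symbol $\left(\frac{a}{n}\right)_k\in\{-1,0,1\}$ is defined to be $1$ if $a^k\equiv 1\pmod n$, $-1$ if $a^k\equiv -1\pmod n$, and $0$ otherwise. The cases are read in order, the first applicable one being used; this matters only for $n=2$. *)

(* Defs.v *)
From mathcomp Require Import all_boot all_order all_algebra.
Set Implicit Arguments.
Unset Strict Implicit.
Unset Printing Implicit Defensive.
Import GRing.Theory.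
Local Open Scope ring_scope.

(* The exponential congruence symbol (a / n)_k, meaningful for n >= 2, k >= 1.
   The order of the tests matters only for n = 2, where 1 = -1 modulo n. *)
Definition expcong_symbol (a : int) (n k : nat) : int :=
  if (a ^+ k == 1 %[mod n%:Z])%Z then 1
  else if (a ^+ k == -1 %[mod n%:Z])%Z then -1
  else 0.

(* Main.v *)
Require Import Defs.
From mathcomp Require Import all_boot all_order all_algebra.
From mathcomp Require Import ring.
Import GRing.Theory.
Local Open Scope ring_scope.

(** If [a * b] is 1 modulo [d], then [a ^+ k] and [b ^+ k] are inverse to each other, and a sign [e]
    is its own inverse, so one power is congruent to [e] exactly when the other is
    ([eq_modz_inv_exp]). Taking [e] to be 1 and -1, each test in the symbol has the same outcome for
    both arguments. *)

Lemma modz_inv_exp (d a b e : int) (k : nat) :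
  (a * b = 1 %[mod d])%Z -> e * e = 1 ->
  (a ^+ k == e %[mod d])%Z -> (b ^+ k == e %[mod d])%Z.
Proof.
move=> hab hee; rewrite !eqz_mod_dvd => hak.
have habk : (d %| (a * b) ^+ k - 1)%Z.
  by rewrite -eqz_mod_dvd -modzXm hab modzXm expr1n.
(* Both terms on the right are multiples of [d]. The identity needs [e * e = 1], which [ring] does
   not know, so the lone [b ^+ k] is first rewritten as [e * e * b ^+ k]. *)
have -> : b ^+ k - e = e * ((a * b) ^+ k - 1) - e * b ^+ k * (a ^+ k - e).
  by rewrite exprMn -[b ^+ k in LHS]mul1r -[1 in LHS]hee; ring.
by rewrite rpredB // dvdz_mull.
Qed.

Lemma eq_modz_inv_exp (d a b e : int) (k : nat) :
  (a * b = 1 %[mod d])%Z -> e * e = 1 ->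
  (b ^+ k == e %[mod d])%Z = (a ^+ k == e %[mod d])%Z.
Proof.
move=> hab hee; apply/idP/idP; apply: modz_inv_exp => //.
by rewrite mulrC.
Qed.

Theorem proposition2p9 (n k : nat) (hn : (2 <= n)%N) (hk : (1 <= k)%N)
    (a : int) (ha : gcdz a n%:Z = 1)
    (ainv : int) (hainv : (a * ainv = 1 %[mod n%:Z])%Z) :
  expcong_symbol ainv n k = expcong_symbol a n k.
Proof. by rewrite /expcong_symbol !(eq_modz_inv_exp _ _ _ _ _ hainv). Qed.
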